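(* Let $G=(V,E)$ be a graph and let $S$ be a minimum zero forcing set of $G$ (i.e. a zero forcing set with $|S|=Z(G)$). Then $F_d(G)\leq Z(G)+\gamma(G-N[S])$.
   Context: Graphs are finite, simple and undirected. Zero forcing: given a set $B\subseteq V(G)$ of initially black vertices (all others white), at each step a black vertex having exactly one white neighbor forces that neighbor to become black; $B$ is a zero forcing set of $G$ if repeated application of this rule turns all vertices black. $Z(G)$ is the minimum cardinality of a zero forcing set. A set $D\subseteq V(G)$ is dominating if every vertex of $G$ is in $D$ or adjacent to a vertex of $D$; $\gamma(G)$ is the minimum cardinality of a dominating set (so $\gamma$ of the graph with no vertices is $0$). A dom-forcing set of $G$ is a set $D_f\subseteq V(G)$ that is both a dominating set of $G$ and a zero forcing set of $G$; $F_d(G)$ is the minimum cardinality of a dom-forcing set. $N[S]$ is the closed neighborhood of $S$ (the vertices in $S$ together with all their neighbors), and $G-N[S]$ is the subgraph of $G$ induced by $V\setminus N[S]$. *)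

(* Defs.v *)
From mathcomp Require Import all_boot.

Set Implicit Arguments.
Unset Strict Implicit.
Unset Printing Implicit Defensive.

Record sgraph := SGraph {
  vertex :> finType;
  adj : rel vertex;
  adj_sym : symmetric adj;
  adj_irr : irreflexive adj }.

Definition nbhd (G : sgraph) (x : G) : {set G} := [set y | adj x y].

Definition closed_nbhd (G : sgraph) (S : {set G}) : {set G} :=
  S :|: \bigcup_(x in S) nbhd x.

Section Induced.
Variables (G : sgraph) (A : {set G}).

Definition induced_adj : rel {x : G | x \in A} :=
  fun x y => adj (val x) (val y).

Lemma induced_adj_sym : symmetric induced_adj.
Proof. by move=> x y; exact: adj_sym. Qed.

Lemma induced_adj_irr : irreflexive induced_adj.
Proof. by move=> x; exact: adj_irr. Qed.

Definition induced : sgraph := SGraph induced_adj_sym induced_adj_irr.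

End Induced.

Definition remove_vertices (G : sgraph) (A : {set G}) : sgraph :=
  induced (~: A).

(* One force, with B the set of black vertices: some black u whose only white
   neighbor is w turns w black. *)
Definition force_step (G : sgraph) : rel {set G} :=
  fun B B' => [exists u in B, [exists w,
    (nbhd u :\: B == [set w]) && (B' == w |: B)]].

Definition zero_forcing (G : sgraph) (B : {set G}) : bool :=
  connect (@force_step G) B [set: G].

Definition dominating (G : sgraph) (D : {set G}) : bool :=
  [forall v, (v \in D) || [exists u in D, adj u v]].

Definition dom_forcing (G : sgraph) (D : {set G}) : bool :=
  dominating D && zero_forcing D.

(* The minima below range over nonempty families, as arg min requires: the full
   vertex set always has each of the three properties. *)
Lemma zero_forcing_setT (G : sgraph) : zero_forcing [set: G].
Proof. exact: connect0. Qed.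

Lemma dominating_setT (G : sgraph) : dominating [set: G].
Proof. by apply/forallP => v; rewrite inE. Qed.

Lemma dom_forcing_setT (G : sgraph) : dom_forcing [set: G].
Proof. by rewrite /dom_forcing dominating_setT zero_forcing_setT. Qed.

Definition zero_forcing_number (G : sgraph) : nat :=
  #|[arg min_(B < [set: G] | zero_forcing B) #|B|]|.

Definition domination_number (G : sgraph) : nat :=
  #|[arg min_(D < [set: G] | dominating D) #|D|]|.

Definition dom_forcing_number (G : sgraph) : nat :=
  #|[arg min_(D < [set: G] | dom_forcing D) #|D|]|.

(* Main.v *)
(* Adding a minimum dominating set of G - N[S] to S dominates G, and the result
   is still zero forcing because enlarging the black set never hurts. *)
Require Import Defs.
From mathcomp Require Import all_boot.

(** Let [D] be a minimum dominating set of $G-N[S]$. Since [S] dominates $N[S]$ and [D] dominates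
    the rest, $S\cup D$ dominates $G$ ([dominating_setU]). It contains [S], so it is zero forcing
    ([zero_forcing_superset]). Hence $F_d(G)\le|S\cup D|\le|S|+|D|$. *)

Lemma force_step_superset {G : sgraph} {B B' C : {set G}} :
  force_step B B' -> B \subset C ->
  exists2 C', connect (@force_step G) C C' & B' \subset C'.
Proof.
case/existsP=> u /andP[uB /existsP[w /andP[/eqP nbhd_w /eqP ->]]] sBC.
have [wC | wC] := boolP (w \in C).
  by exists C; [exact: connect0 | rewrite subUset sub1set wC].
(* Enlarging [B] to [C] creates no white neighbor of [u], so the still white [w] remains the only
   one and [u] forces it. *)
exists (w |: C); last exact: setUS.
apply/connect1/existsP; exists u; rewrite (subsetP sBC _ uB) /=.
apply/existsP; exists w; rewrite eqxx andbT eqEsubset; apply/andP; split.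
  by rewrite -nbhd_w setDS.
have: w \in nbhd u :\: B by rewrite nbhd_w set11.
by rewrite sub1set !in_setD wC => /andP[_].
Qed.

(** Each force from [B] is matched from [C] by at most one force that preserves inclusion; the
    induction on the forcing sequence thus lets [C] vary. *)
Lemma zero_forcing_superset {G : sgraph} {B C : {set G}} :
  B \subset C -> zero_forcing B -> zero_forcing C.
Proof.
move=> sBC /connectP[p]; elim: p B C sBC => [|B' p IHp] B C sBC /=.
  move=> _ defB; move: sBC; rewrite -defB subTset => /eqP->.
  exact: zero_forcing_setT.
case/andP=> stepB pathp lastp.
have [C' CC' sB'C'] := force_step_superset stepB sBC.
exact: connect_trans CC' (IHp _ _ sB'C' pathp lastp).
Qed.

Lemma dominating_setU {G : sgraph} {S : {set G}}
    {D : {set remove_vertices (closed_nbhd S)}} :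
  dominating D -> dominating (S :|: [set val x | x in D]).
Proof.
move=> /forallP domD; apply/forallP => v.
have [|vNS] := boolP (v \in closed_nbhd S).
  rewrite !inE => /orP[-> // | /bigcupP[u uS]].
  rewrite inE => uv; apply/orP; right; apply/existsP; exists u.
  by rewrite inE uS uv.
(* Now [v] is a vertex of $G-N[S]$, where adjacency is that of $G$ on underlying vertices, so a
   dominator in [D] also dominates [v] in $G$. *)
have vP : v \in ~: closed_nbhd S by rewrite inE.
have /orP[vD | /existsP[u /andP[uD uv]]] := domD (exist _ v vP).
  by rewrite inE (imset_f val vD) orbT.
apply/orP; right; apply/existsP; exists (val u).
by rewrite inE (imset_f val uD) orbT.
Qed.

Theorem proposition1p4 (G : sgraph) (S : {set G}) :
  zero_forcing S -> #|S| = zero_forcing_number G ->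
  dom_forcing_number G <=
    zero_forcing_number G + domination_number (remove_vertices (closed_nbhd S)).
Proof.
move=> zfS <-; rewrite /domination_number.
case: arg_minnP => [|D domD _]; first exact: dominating_setT.
rewrite /dom_forcing_number.
case: arg_minnP => [|F _ minF]; first exact: dom_forcing_setT.
have /minF /leq_trans-> // : dom_forcing (S :|: [set val x | x in D]).
  by rewrite /dom_forcing dominating_setU //= (zero_forcing_superset _ zfS) ?subsetUl.
rewrite (leq_trans (leq_card_setU _ _)) // leq_add2l.
exact: leq_imset_card.
Qed.
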